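(* Let $\Gamma=\Gamma_d(a_1,b_1,c_1,\ldots,a_t,b_t,c_t;m_1,\ldots,m_t)$ have order $n$, where $d$, $t$ and the $a_i,b_i,c_i$ are fixed and $n=(d+1)(m_1+\cdots+m_t)\to\infty$, and let $L=\max\{a_jb_jc_j: j=1,\ldots,t\}$. Then $\mu(\Gamma)\le(1+o(1))\frac{L\pi^2}{n^2}$.
   Context: $\mu$ is the second smallest eigenvalue of the Laplacian (degree matrix minus adjacency matrix). The sequential join $G_1+\cdots+G_k$ joins every vertex of $G_i$ to every vertex of $G_{i+1}$. $\mathcal{G}(a,b,c;m)$ is the sequential join of $3m$ cliques $K_a,K_b,K_c,\ldots,K_a,K_b,K_c$ (its cells). For $d\ge2$, $t\ge1$ and positive integers with $a_i+b_i+c_i=d+1$, $\Gamma_d(a_1,b_1,c_1,\ldots,a_t,b_t,c_t;m_1,\ldots,m_t)$ is obtained from the disjoint union of $\mathcal{G}_i=\mathcal{G}(a_i,b_i,c_i;m_i)$, $i=1,\ldots,t$, by joining every vertex of the last cell of $\mathcal{G}_i$ to every vertex of the first cell of $\mathcal{G}_{i+1}$ for $i=1,\ldots,t-1$. *)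

(* Defs.v *)
From HB Require Import structures.
From mathcomp Require Import all_boot all_order all_algebra.
From mathcomp Require Import polyrcf.

Set Implicit Arguments.
Unset Strict Implicit.
Unset Printing Implicit Defensive.

Import Order.TTheory GRing.Theory Num.Theory.

Record sgraph := SGraph {
  vert :> finType;
  adj : rel vert;
  adj_sym : symmetric adj;
  adj_irrefl : irreflexive adj }.

Section Constructions.

Definition clique_adj (n : nat) : rel 'I_n := fun x y => x != y.

Lemma clique_adj_sym n : symmetric (@clique_adj n).
Proof. by move=> x y; rewrite /clique_adj eq_sym. Qed.

Lemma clique_adj_irrefl n : irreflexive (@clique_adj n).
Proof. by move=> x; rewrite /clique_adj eqxx. Qed.

Definition clique (n : nat) : sgraph :=
  SGraph (@clique_adj_sym n) (@clique_adj_irrefl n).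

(* Adjacency in the disjoint union of G 0, ..., G (k - 1), together with the
   edges joining every vertex of G i satisfying [out i] to every vertex of
   G i.+1 satisfying [inn i.+1]. *)
Section Chain.
Variables (k : nat) (G : 'I_k -> sgraph).
Variables (out inn : forall i, pred (G i)).

Definition bridge (u v : {i : 'I_k & G i}) : bool :=
  [&& (tag u).+1 == tag v :> nat, out (tagged u) & inn (tagged v)].

Definition chain_adj (u v : {i : 'I_k & G i}) : bool :=
  [|| (tag u == tag v) && adj (tagged u) (tagged_as u v),
      bridge u v | bridge v u].

Lemma chain_adj_sym : symmetric chain_adj.
Proof.
move=> [i x] [j y]; rewrite /chain_adj [bridge _ _ || _]orbC /=.
congr (_ || _); have [eij|nij] := eqVneq i j; last by [].
by move: y; rewrite -eij => y; rewrite !tagged_asE adj_sym.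
Qed.

Lemma chain_adj_irrefl : irreflexive chain_adj.
Proof.
move=> [i x]; rewrite /chain_adj /bridge /= eqxx tagged_asE adj_irrefl.
by rewrite (gtn_eqF (ltnSn i)).
Qed.

Definition chain : sgraph := SGraph chain_adj_sym chain_adj_irrefl.

End Chain.

Definition seqjoin (k : nat) (G : 'I_k -> sgraph) : sgraph :=
  @chain k G (fun _ => xpredT) (fun _ => xpredT).

Definition cell_size (a b c i : nat) : nat := nth 0 [:: a; b; c] (i %% 3).

Definition cellgraph (a b c m : nat) : sgraph :=
  seqjoin (fun i : 'I_(3 * m) => clique (cell_size a b c i)).

Definition first_cell (a b c m : nat) : pred (cellgraph a b c m) :=
  fun x => tag x == 0 :> nat.

Definition last_cell (a b c m : nat) : pred (cellgraph a b c m) :=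
  fun x => (tag x).+1 == 3 * m.

Definition Gamma (t : nat) (a b c m : 'I_t -> nat) : sgraph :=
  @chain t (fun i => cellgraph (a i) (b i) (c i) (m i))
    (fun i => @last_cell (a i) (b i) (c i) (m i))
    (fun i => @first_cell (a i) (b i) (c i) (m i)).

Lemma card_cellgraph a b c m : #|cellgraph a b c m| = (a + b + c) * m.
Proof.
rewrite card_tagged sumnE big_map big_enum /=.
under eq_bigr do rewrite card_ord.
rewrite -(big_mkord xpredT (cell_size a b c)).
elim: m => [|m IH]; first by rewrite !muln0 big_geq.
rewrite mulnS addnC addn3 !big_nat_recr //= IH mulnS /cell_size.
rewrite -[(3 * m).+2]addn2 -[(3 * m).+1]addn1 ![3 * m]mulnC modnMl !modnMDl /=.
by rewrite [RHS]addnC !addnA.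
Qed.

Lemma card_Gamma (d t : nat) (a b c m : 'I_t -> nat) :
  (forall i, a i + b i + c i = d.+1) ->
  #|Gamma a b c m| = d.+1 * \sum_(i < t) m i.
Proof.
move=> abc; rewrite card_tagged sumnE big_map big_enum /= big_distrr /=.
by apply: eq_bigr => i _; rewrite card_cellgraph abc.
Qed.

End Constructions.

Section Spectrum.
Local Open Scope ring_scope.
Variable R : rcfType.

Definition adjacency_mx (G : sgraph) : 'M[R]_#|G| :=
  \matrix_(i, j) (adj (enum_val i) (enum_val j))%:R.

Definition degree (G : sgraph) (x : G) : nat := #|[set y | adj x y]|.

Definition degree_mx (G : sgraph) : 'M[R]_#|G| :=
  diag_mx (\row_i (degree (enum_val i))%:R).

Definition laplacian (G : sgraph) : 'M[R]_#|G| :=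
  degree_mx G - adjacency_mx G.

(* The eigenvalues in R in nondecreasing order, each repeated according to its
   algebraic multiplicity ([rootsR] is strictly increasing).  For a symmetric
   matrix of size n this sequence has length n. *)
Definition eigenvalues n (A : 'M[R]_n) : seq R :=
  flatten [seq nseq (mup x (char_poly A)) x | x <- rootsR (char_poly A)].

(* The second smallest eigenvalue, counted with multiplicity; the default value
   of [nth] is only reached when G has at most one vertex. *)
Definition mu (G : sgraph) : R := nth 0 (eigenvalues (laplacian G)) 1.

End Spectrum.

(* Main.v *)
(* The graph is a long sequential join of cliques, on which a function constant on
   cells behaves like a function on a weighted path.  Give each cell of the k-th
   triple K_a, K_b, K_c the value interpolating between phi k and phi (k + 1) with
   the unit-current potential of the triple.  Its conductances ab, bc, ca in series
   have effective conductance abc / (d + 1), so the triple contributes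
   abc / (d + 1) * (phi (k + 1) - phi k)^2 <= L / (d + 1) * (phi (k + 1) - phi k)^2
   to the Dirichlet energy.  With M = n / (d + 1) triples and phi the slowest mode
   cos (pi (k + 1/2) / M) of the path, the energy is at most
   L / (d + 1) * (pi / M)^2 * M / 2 + O(1 / M^2), the second term coming from the t - 1
   places where the parameters change, while the variance is (d + 1) M / 2 - O(1).
   The quotient is (1 + O(1 / n)) L pi^2 / n^2, with constants depending on d and t
   only.  For each of the remaining small n there are finitely many graphs. *)
Require Import Defs.
From mathcomp Require Import all_boot all_order all_algebra.
From mathcomp Require Import all_classical all_reals all_analysis.
From mathcomp Require Import polyrcf complex ring lra zify.
Import Order.TTheory GRing.Theory Num.Theory.
Import numFieldNormedType.Exports.
Local Open Scope classical_set_scope.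
Local Open Scope ring_scope.

Set Implicit Arguments.
Unset Strict Implicit.
Unset Printing Implicit Defensive.

(** * Rayleigh quotients and the second eigenvalue of a Laplacian *)

(** Links the definition of [eigenvalues], distinct roots repeated by multiplicity, to an arbitrary
    listing of the spectrum. *)
Lemma perm_flatten_nseq_count (T : eqType) (s u : seq T) :
  uniq u -> u =i s -> perm_eq (flatten [seq nseq (count_mem x s) x | x <- u]) s.
Proof.
move=> Uu eq_us; apply/allP => x _; apply/eqP.
rewrite count_flatten -map_comp.
under eq_map => y do rewrite /= count_nseq /= .
have [xs|xNs] := boolP (x \in s); last first.
  rewrite (count_memPn xNs); apply/eqP; rewrite sumnE big_map big_seq big1 // => y.
  by rewrite eq_us; case: eqP => [->|//]; rewrite (negPf xNs).
rewrite sumnE big_map (bigD1_seq x) ?eq_us //= eqxx mul1n big1 ?addn0 // => y.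
by move=> /negPf ->.
Qed.

Lemma sorted_flatten_nseq d (T : orderType d) (k : T -> nat) (u : seq T) :
  sorted <%O u -> sorted <=%O (flatten [seq nseq (k x) x | x <- u]).
Proof.
rewrite !(lt_sorted_pairwise, le_sorted_pairwise).
elim: u => //= x u IHu /andP[xu /IHu su].
rewrite pairwise_cat su andbT; apply/andP; split.
  apply/allrelP => y z; rewrite mem_nseq => /andP[_ /eqP->].
  by case/flatten_mapP=> w /(allP xu) xw; rewrite mem_nseq => /andP[_ /eqP->]; exact: ltW.
by elim: (k x) => //= m ->; rewrite andbT all_nseq lexx orbT.
Qed.

Lemma char_poly_similar (F : comUnitRingType) n (P A B : 'M[F]_n) :
  P \in unitmx -> A = invmx P *m B *m P -> char_poly A = char_poly B.
Proof.
move=> uP ->; rewrite /char_poly.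
pose Q := map_mx polyC P; pose Q' := map_mx polyC (invmx P).
have Q'Q : Q' *m Q = 1%:M by rewrite -map_mxM mulVmx // map_mx1.
have -> : char_poly_mx (invmx P *m B *m P) = Q' *m char_poly_mx B *m Q.
  rewrite /char_poly_mx mulmxBr mulmxBl !map_mxM.
  by rewrite mul_mx_scalar -scalemxAl Q'Q scalemx1.
rewrite !det_mulmx mulrC mulrA -det_mulmx.
by rewrite (mulmx1C Q'Q) det1 mul1r.
Qed.

(** In a sorted sequence only the head can lie strictly below the entry of index 1, and counting is
    invariant under permutation. Sequences with at most one entry, where [x0] is returned, obey the
    same count. *)
Lemma sorted_nth1_le d (T : orderType d) (x0 : T) n (s : seq T) (r : 'I_n -> T) :
  sorted <=%O s -> perm_eq s [seq r i | i <- enum 'I_n] ->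
  forall i j, (r i < nth x0 s 1)%O -> (r j < nth x0 s 1)%O -> i = j.
Proof.
move=> ss /permP /(_ (fun x => (x < nth x0 s 1)%O)); rewrite count_map.
rewrite enumT -[RHS]size_filter => ct.
have cle1 : (count (fun x => (x < nth x0 s 1)%O) s <= 1)%N.
  case: s ss {ct} => [|x0' [|x1 s]] //=; first by rewrite addn0; case: (_ < _)%O.
  move=> /andP[_ p1]; rewrite ltxx add0n.
  suff -> : count (fun x => (x < x1)%O) s = 0%N by rewrite addn0; case: (_ < _)%O.
  apply/eqP; rewrite -leqn0 leqNgt -has_count; apply/hasPn => x xs.
  by rewrite -leNgt; move: (order_path_min le_trans p1) => /allP; apply.
move=> i j ri rj.
have : (#|[pred i | (r i < nth x0 s 1)%O]| <= 1)%N.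
  by rewrite cardE /enum_mem; rewrite ct in cle1.
by move/card_le1_eqP; apply.
Qed.

Local Open Scope sesquilinear_scope.

Lemma hermitian_diag_form (C : numClosedFieldType) n (y d : 'rV[C]_n) :
  (y *m diag_mx d *m y ^t*) 0 0 = \sum_i d 0 i * `|y 0 i| ^+ 2.
Proof.
by rewrite mxE; apply: eq_bigr => i _; rewrite mul_mx_diag !mxE normCK mulrAC mulrC.
Qed.

Section SymmetricSpectrum.
Variable R : rcfType.
Local Notation C := R[i].
Local Notation toC := (map_mx (real_complex R)).

Lemma real_complexJ (x : R) : Num.conj (real_complex R x) = real_complex R x.
Proof. by apply/CrealP; apply/complex_realP; exists x. Qed.

(** Over [R[i]] the matrix is Hermitian, so it is unitarily diagonalizable with real diagonal;
    taking real parts of that diagonal loses nothing. *)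
Lemma symmetric_spectral n (A : 'M[R]_n) : A^T = A ->
  exists P : 'M[C]_n, exists2 r : 'rV[R]_n, P \is unitarymx &
    toC A = P ^t* *m diag_mx (toC r) *m P.
Proof.
move=> symA.
have hA : toC A \is hermsymmx.
  apply: realsym_hermsym.
    by apply/is_hermitianmxP; rewrite expr0 scale1r map_mx_id // map_trmx symA.
  by apply/mxOverP => i j; rewrite mxE; apply/complex_realP; exists (A i j).
have realD := hermitian_spectral_diag_real hA.
exists (spectralmx (toC A)), (map_mx (@complex.Re R) (spectral_diag (toC A))).
  exact: spectral_unitarymx.
rewrite -invmx_unitary ?spectral_unitarymx //.
have -> : toC (map_mx (@complex.Re R) (spectral_diag (toC A))) = spectral_diag (toC A).
  by apply/matrixP => i j; rewrite !mxE RRe_real //; apply: (mxOverP realD).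
exact/orthomx_spectralP/hermitian_normalmx.
Qed.

(** The characteristic polynomial splits over [R]: the factorization holds over [R[i]] by
    similarity, and embedding coefficients is injective. *)
Lemma perm_eigenvalues n (A : 'M[R]_n) (P : 'M[C]_n) (r : 'rV[R]_n) :
  P \is unitarymx -> toC A = P ^t* *m diag_mx (toC r) *m P ->
  perm_eq (eigenvalues A) [seq r 0 i | i <- enum 'I_n].
Proof.
move=> uP eA.
have e : char_poly A = \prod_(x <- [seq r 0 i | i <- enum 'I_n]) ('X - x%:P).
  apply: (@map_poly_inj _ _ (real_complex R)).
  rewrite map_char_poly (char_poly_similar (unitarymx_unit uP) (B := diag_mx (toC r))).
    rewrite char_poly_trig ?diag_mx_is_trig // big_map big_enum rmorph_prod.
    by apply: eq_bigr => i _ /=; rewrite map_polyXsubC !mxE eqxx mulr1n.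
  by rewrite invmx_unitary.
have pn0 : char_poly A != 0 by rewrite monic_neq0 ?char_poly_monic.
rewrite /eigenvalues; under eq_map => x do rewrite {1}e mu_prod_XsubC.
apply: perm_flatten_nseq_count.
  by rewrite (sorted_uniq lt_trans (@ltxx _ _)) // sorted_roots.
by move=> x; rewrite -roots_on_rootsR //= e root_prod_XsubC.
Qed.

Lemma sorted_eigenvalues n (A : 'M[R]_n) : sorted <=%R (eigenvalues A).
Proof. by apply: sorted_flatten_nseq; apply: sorted_roots. Qed.

(* A positive second eigenvalue leaves the line of [v] as the only eigenline below it,
   and [z] has no component there. *)
Lemma second_eigenvalue_rayleigh n (A : 'M[R]_n) (v z : 'rV[R]_n) :
  A^T = A -> v != 0 -> v *m A = 0 -> z *m v^T = 0 -> 0 < (eigenvalues A)`_1 ->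
  (eigenvalues A)`_1 * (z *m z^T) 0 0 <= (z *m A *m z^T) 0 0.
Proof.
move=> symA vn0 vA zv m0; set m := _`_1 in m0 *.
have [P [r uP eA]] := symmetric_spectral symA.
have sep := sorted_nth1_le (sorted_eigenvalues A) (perm_eigenvalues uP eA).
have PP := unitarymxP uP; have PP' := mulmx1C PP.
(* Coordinates of [v] and [z] in the eigenbasis; [P] being unitary, orthogonality and both quadratic
   forms carry over. *)
pose w := toC v *m P ^t*; pose y := toC z *m P ^t*.
have conjy : y ^t* = P *m toC z^T.
  rewrite /y trmx_mul map_mxM /= trmxCK; congr (_ *m _).
  by apply/matrixP => i j; rewrite !mxE real_complexJ.
have conjw : w ^t* = P *m toC v^T.
  rewrite /w trmx_mul map_mxM /= trmxCK; congr (_ *m _).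
  by apply/matrixP => i j; rewrite !mxE real_complexJ.
have yw : y *m w ^t* = 0.
  rewrite conjw /y mulmxA -(mulmxA _ _ P) PP' mulmx1 -map_mxM zv map_mx0 //.
have wn0 : w != 0.
  apply: contra vn0 => /eqP w0; apply/eqP/(map_mx_inj (f := real_complex R)).
  by rewrite map_mx0 -[LHS]mulmx1 -PP' mulmxA -/w w0 mul0mx.
have wD i : w 0 i * (r 0 i)%:C%C = 0.
  have : w *m diag_mx (toC r) = 0.
    have : toC v *m (P ^t* *m diag_mx (toC r) *m P) *m P ^t* = 0.
      by rewrite -eA -map_mxM vA map_mx0 mul0mx.
    by rewrite !mulmxA -(mulmxA _ P) PP mulmx1.
  by move/matrixP/(_ 0 i); rewrite mul_mx_diag !mxE.
have zz : real_complex R ((z *m z^T) 0 0) = \sum_i `|y 0 i| ^+ 2.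
  have -> : real_complex R ((z *m z^T) 0 0) = (y *m y ^t*) 0 0.
    by rewrite conjy /y mulmxA -(mulmxA _ _ P) PP' mulmx1 -map_mxM [RHS]mxE.
  rewrite -[y in y *m _]mulmx1 -diag_const_mx hermitian_diag_form.
  by apply: eq_bigr => i _; rewrite mxE mul1r.
have zAz : real_complex R ((z *m A *m z^T) 0 0) = \sum_i (r 0 i)%:C%C * `|y 0 i| ^+ 2.
  have -> : real_complex R ((z *m A *m z^T) 0 0) = (y *m diag_mx (toC r) *m y ^t*) 0 0.
    have -> : real_complex R ((z *m A *m z^T) 0 0) = (toC (z *m A *m z^T)) 0 0.
      by rewrite [RHS]mxE.
    by rewrite conjy /y !map_mxM eA !mulmxA.
  by rewrite hermitian_diag_form; apply: eq_bigr => i _; rewrite mxE.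
clearbody y w.
have [i0 wi0] : exists i, w 0 i != 0.
  apply/existsP; apply: contraNT wn0; rewrite negb_exists => /forallP h.
  by apply/eqP/rowP => i; rewrite [in RHS]mxE; have := h i; rewrite negbK => /eqP.
have ri0 : r 0 i0 = 0.
  by have /eqP := wD i0; rewrite mulf_eq0 (negPf wi0) /= => /eqP [].
(* Index [i0] carries the eigenvalue 0 < [m], and at most one index lies below [m]. Hence [w] is
   supported on [i0], and orthogonality kills [y] there. *)
have big i : i != i0 -> m <= r 0 i.
  move=> ne; rewrite leNgt; apply: contraNN ne => lt.
  by apply/eqP; apply: (sep 0); rewrite // ri0.
have wi i : i != i0 -> w 0 i = 0.
  move=> /big mr; have /eqP := wD i; rewrite mulf_eq0 => /orP[/eqP//|/eqP [r0]].
  by move: mr; rewrite r0 leNgt m0.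
have yi0 : y 0 i0 = 0.
  have := congr1 (fun M : 'M[C]_1 => M 0 0) yw; rewrite !mxE (bigD1 i0) //= big1 => [|i ne].
    by rewrite addr0 !mxE => /eqP; rewrite mulf_eq0 conjC_eq0 (negPf wi0) orbF => /eqP.
  by rewrite !mxE (wi i ne) conjC0 mulr0.
rewrite -lecR rmorphM /= zz zAz.
rewrite mulr_sumr; apply: ler_sum => i _.
have [->|/big mr] := eqVneq i i0; first by rewrite yi0 normr0 expr0n !mulr0.
by apply: ler_wpM2r; [rewrite exprn_ge0 // normr_ge0 | rewrite lecR].
Qed.

End SymmetricSpectrum.

Local Close Scope sesquilinear_scope.

(** * The Laplacian quadratic form and the Rayleigh bound for [mu] *)

Section Laplacian.
Variable R : rcfType.

(* Every edge is counted in both directions. *)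
Definition dirichlet (G : sgraph) (f : G -> R) : R :=
  \sum_x \sum_y (adj x y)%:R * (f x - f y) ^+ 2.

Lemma dirichlet_ge0 (G : sgraph) (f : G -> R) : 0 <= dirichlet f.
Proof. by apply: sumr_ge0 => x _; apply: sumr_ge0 => y _; rewrite mulr_ge0 ?sqr_ge0. Qed.

Definition fun_row (G : sgraph) (f : G -> R) : 'rV[R]_#|G| :=
  \row_i f (enum_val i).

Lemma sum_enum_val (G : finType) (F : G -> R) :
  \sum_(i < #|G|) F (enum_val i) = \sum_x F x.
Proof. by rewrite -big_enum_val. Qed.

Lemma laplacian_sym (G : sgraph) : (laplacian R G)^T = laplacian R G.
Proof.
rewrite /laplacian linearB /= tr_diag_mx; congr (_ - _).
by apply/matrixP => i j; rewrite !mxE adj_sym.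
Qed.

Lemma fun_row_laplacian (G : sgraph) (f : G -> R) j :
  (fun_row f *m laplacian R G) 0 j =
  \sum_x (adj (enum_val j) x)%:R * (f (enum_val j) - f x).
Proof.
rewrite /laplacian mulmxBr mul_mx_diag !mxE.
under [in RHS]eq_bigr do rewrite mulrBr; rewrite sumrB -mulr_suml; congr (_ - _).
  rewrite mulrC; congr (_ * _).
  by rewrite /degree -sum1_card natr_sum big_mkcond; apply: eq_bigr => x _; rewrite inE; case: adj.
rewrite -[RHS]sum_enum_val; apply: eq_bigr => i _; rewrite !mxE mulrC.
by rewrite adj_sym.
Qed.

Lemma laplacian_form (G : sgraph) (f : G -> R) :
  (fun_row f *m laplacian R G *m (fun_row f)^T) 0 0 *+ 2 = dirichlet f.
Proof.
rewrite mxE; under eq_bigr do rewrite fun_row_laplacian !mxE.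
rewrite (sum_enum_val (fun y => (\sum_x (adj y x)%:R * (f y - f x)) * f y)) mulr2n.
under eq_bigr do rewrite mulr_suml.
rewrite [X in _ + X]exchange_big /= -big_split /=; apply: eq_bigr => x _.
rewrite -big_split /=; apply: eq_bigr => y _.
by rewrite [adj y x]adj_sym; ring.
Qed.

Lemma fun_row_dot (G : sgraph) (f g : G -> R) :
  (fun_row f *m (fun_row g)^T) 0 0 = \sum_x f x * g x.
Proof. by rewrite -sum_enum_val mxE; apply: eq_bigr => i _; rewrite !mxE. Qed.

(** Subtracting the mean makes [f] orthogonal to the constants, which the Laplacian kills, and
    leaves the Dirichlet sum unchanged. The parenthesis is the squared norm of the centred
    function. *)
Lemma mu_rayleigh (G : sgraph) (f : G -> R) :
  mu R G * (\sum_x f x ^+ 2 - (\sum_x f x) ^+ 2 / #|G|%:R) *+ 2 <= dirichlet f.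
Proof.
have [G0|G_gt0] := posnP #|G|.
  have no (F : G -> R) : \sum_x F x = 0 by rewrite big1 // => x; case: (fintype0 x G0).
  by rewrite !no expr0n mul0r subrr mulr0 mul0rn dirichlet_ge0.
have n0 : #|G|%:R != 0 :> R by rewrite pnatr_eq0 -lt0n.
pose e := (\sum_x f x) / #|G|%:R; pose g x := f x - e.
have sum1 : \sum_(x : G) e = \sum_x f x.
  by rewrite sumr_const -mulr_natr divfK.
have sumg : \sum_x g x = 0 by rewrite sumrB sum1 subrr.
have -> : \sum_x f x ^+ 2 - (\sum_x f x) ^+ 2 / #|G|%:R = \sum_x g x * g x.
  have -> : \sum_x g x * g x = \sum_x f x ^+ 2 - e * \sum_x f x.
    transitivity (\sum_x (f x ^+ 2 - e * f x - e * g x)).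
      by apply: eq_bigr => x _; rewrite /g; ring.
    by rewrite !sumrB -!mulr_sumr sumg mulr0 subr0.
  by rewrite /e expr2 mulrAC.
have -> : dirichlet f = dirichlet g.
  by apply: eq_bigr => x _; apply: eq_bigr => y _; rewrite /g; ring.
rewrite -laplacian_form lerMn2r /= -fun_row_dot.
have form_ge0 : 0 <= (fun_row g *m laplacian R G *m (fun_row g)^T) 0 0.
  by have := dirichlet_ge0 g; rewrite -laplacian_form pmulrn_lge0.
have dot_ge0 : 0 <= (fun_row g *m (fun_row g)^T) 0 0.
  by rewrite fun_row_dot sumr_ge0 // => x _; rewrite -expr2 sqr_ge0.
(* A nonpositive value makes the bound trivial, since the form is nonnegative; this includes the
   default value 0 on a single vertex. *)
have [mu_le0|mu_gt0] := lerP (mu R G) 0.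
  by apply: le_trans form_ge0; rewrite mulr_le0_ge0.
apply: (@second_eigenvalue_rayleigh _ _ _ (fun_row (fun _ : G => 1))) => //.
- exact: laplacian_sym.
- apply/eqP => /rowP /(_ (Ordinal G_gt0)).
  by rewrite !mxE => /eqP; rewrite oner_eq0.
- apply/rowP => j; rewrite fun_row_laplacian mxE big1 // => x _.
  by rewrite subrr mulr0.
- apply/matrixP => i j; rewrite !ord1 fun_row_dot mxE.
  by under eq_bigr do rewrite mulr1.
Qed.

End Laplacian.

(** * Energy of the interpolated test function *)

Lemma sum_tagged (V : nmodType) (I : finType) (T : I -> finType)
    (F : {i : I & T i} -> V) :
  \sum_u F u = \sum_i \sum_(x : T i) F (Tagged T x).
Proof.
rewrite (sig_big_dep _ _ (fun i (x : T i) => F (Tagged T x))) /=.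
by apply: eq_big => // -[].
Qed.

Lemma sum_unique_le (R : numDomainType) (I : finType) (P : pred I)
    (F : I -> R) (B : R) : 0 <= B ->
  (forall i j, P i -> P j -> i = j) -> (forall i, P i -> F i <= B) ->
  \sum_(i | P i) F i <= B.
Proof.
move=> B0 uP FB; case: (pickP P) => [i Pi|P0]; last by rewrite big_pred0.
by rewrite (big_pred1 i) ?FB // => j; apply/idP/eqP => [/uP|->//]; apply.
Qed.

Lemma big_ord_mul3 (V : nmodType) (F : nat -> V) m :
  \sum_(j < 3 * m) F j =
  \sum_(k < m) (F (3 * k)%N + F (3 * k).+1 + F (3 * k).+2).
Proof.
elim: m => [|m IH]; first by rewrite muln0 !big_ord0.
by rewrite mulnS addnC addn3 !big_ord_recr /= IH !addrA.
Qed.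

(** The index is a plain natural number so that [offset m t], the total number of periods, makes
    sense. *)
Definition offset t (m : 'I_t -> nat) (i : nat) : nat := (\sum_(j < t | (j < i)%N) m j)%N.

Lemma offsetS t (m : 'I_t -> nat) (i : 'I_t) : offset m i.+1 = (offset m i + m i)%N.
Proof.
rewrite /offset (bigD1 i) /= ?leqnn // addnC; congr (_ + _)%N.
by apply: eq_bigl => j; rewrite ltnS ltn_neqAle andbC.
Qed.

Lemma offset_full t (m : 'I_t -> nat) : offset m t = (\sum_i m i)%N.
Proof. by apply: eq_bigl => j; rewrite ltn_ord. Qed.

Lemma sum_offset (V : nmodType) t (m : 'I_t -> nat) (F : nat -> V) :
  \sum_(i < t) \sum_(k < m i) F (offset m i + k)%N = \sum_(k < \sum_i m i) F k.
Proof.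
rewrite -offset_full.
suff H s : (s <= t)%N -> \sum_(i < t | (i < s)%N) \sum_(k < m i) F (offset m i + k)%N =
    \sum_(k < offset m s) F k.
  by rewrite -H //; apply: eq_bigl => i; rewrite ltn_ord.
elim: s => [|s IH] st.
  have -> : offset m 0 = 0%N by rewrite /offset big_pred0.
  by rewrite big_ord0 big_pred0.
rewrite (offsetS m (Ordinal st)) big_split_ord /= -IH; last exact: ltnW.
rewrite (bigD1 (Ordinal st)) /= ?leqnn // addrC; congr (_ + _).
by apply: eq_bigl => j; rewrite ltnS ltn_neqAle andbC.
Qed.

Section Chain.
Variable R : rcfType.
Local Notation Tag G x := (Tagged (fun i => Finite.sort (vert (G i))) x).

(** The indicator of a disjunction is at most the sum of the indicators; forward and backward
    bridges contribute equally, hence the doubling. *)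
Lemma dirichlet_chain_le k (G : 'I_k -> sgraph) (out inn : forall i, pred (G i))
    (f : chain out inn -> R) :
  dirichlet f <= \sum_i dirichlet (fun x : G i => f (Tag G x)) +
    (\sum_(i < k) \sum_(j < k | i.+1 == j :> nat)
       \sum_(x : G i | out i x) \sum_(y : G j | inn j y)
         (f (Tag G x) - f (Tag G y)) ^+ 2) *+ 2.
Proof.
pose inner (u v : chain out inn) : R :=
  ((tag u == tag v) && adj (tagged u) (tagged_as u v))%:R * (f u - f v) ^+ 2.
pose outer (u v : chain out inn) : R := (bridge out inn u v)%:R * (f u - f v) ^+ 2.
have le1 : dirichlet f <= \sum_u \sum_v (inner u v + outer u v + outer v u).
  apply: ler_sum => u _; apply: ler_sum => v _.
  have -> : outer v u = (bridge out inn v u)%:R * (f u - f v) ^+ 2.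
    by rewrite /outer -sqrrN opprB.
  rewrite /inner /outer -!mulrDl -!natrD ler_wpM2r ?sqr_ge0 // ler_nat /=.
  rewrite /chain_adj; case: (_ && _) => //=; case: bridge => //=.
apply: le_trans le1 _.
rewrite (eq_bigr (fun u => \sum_v inner u v + \sum_v outer u v + \sum_v outer v u)); last first.
  by move=> u _; rewrite !big_split.
rewrite !big_split /= [X in _ + X]exchange_big /= -addrA -mulr2n.
have -> : \sum_u \sum_v inner u v = \sum_i dirichlet (fun x : G i => f (Tag G x)).
  rewrite sum_tagged; apply: eq_bigr => i _; apply: eq_bigr => x _.
  rewrite sum_tagged (bigD1 i) //= [X in _ + X]big1 ?addr0 => [|j ne].
    by apply: eq_bigr => y _; rewrite /inner /= eqxx tagged_asE.
  by apply: big1 => y _; rewrite /inner /= eq_sym (negPf ne) mul0r.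
rewrite lerD2l lerMn2r /= le_eqVlt; apply/orP; left; apply/eqP.
rewrite sum_tagged; apply: eq_bigr => i _.
rewrite (eq_bigr _ (fun x _ => sum_tagged _)).
rewrite exchange_big [RHS]big_mkcond /=; apply: eq_bigr => j _.
have [ij|ij] := boolP (i.+1 == j :> nat); last first.
  by apply: big1 => x _; apply: big1 => y _; rewrite /outer /bridge /= (negPf ij) mul0r.
rewrite [RHS]big_mkcond; apply: eq_bigr => x _.
rewrite /outer /bridge /= ij; case: (out i x); last by apply: big1 => y _; rewrite mul0r.
rewrite [RHS]big_mkcond; apply: eq_bigr => y _.
by case: (inn j y); rewrite (mul1r, mul0r).
Qed.

(** Edges inside a cell see no difference. The term from the last cell to a fictitious next one is
    nonnegative, and keeping it lets the sum consist of whole periods. *)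
Lemma dirichlet_clique_chain_le k (s : nat -> nat) (v : nat -> R) :
  dirichlet (fun x : seqjoin (fun i : 'I_k => clique (s i)) => v (tag x)) <=
  (\sum_(j < k) (s j * s j.+1)%:R * (v j - v j.+1) ^+ 2) *+ 2.
Proof.
apply: le_trans (dirichlet_chain_le _) _.
rewrite big1 ?add0r => [|i _]; last first.
  by apply: big1 => x _; apply: big1 => y _; rewrite subrr expr0n mulr0.
rewrite lerMn2r /=; apply: ler_sum => i _.
apply: sum_unique_le => [|j j' /eqP ij /eqP ij'|j /eqP ij].
- by rewrite mulr_ge0 ?sqr_ge0.
- by apply: val_inj; rewrite -[LHS]ij.
by rewrite /= !sumr_const !card_ord -ij -mulrnA mulr_natl mulnC.
Qed.

Lemma sum_seqjoin_clique k (s : nat -> nat) (F : nat -> R) :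
  \sum_(x : seqjoin (fun i : 'I_k => clique (s i))) F (tag x) =
  \sum_(j < k) F j *+ s j.
Proof. by rewrite sum_tagged; apply: eq_bigr => j _; rewrite /= sumr_const card_ord. Qed.

Lemma cell_size_mod3 a b c k :
  (cell_size a b c (3 * k) = a) * (cell_size a b c (3 * k).+1 = b) *
  (cell_size a b c (3 * k).+2 = c) * (cell_size a b c (3 * k).+3 = a).
Proof.
rewrite /cell_size -[(3 * k).+3]addn3 -[(3 * k).+2]addn2 -[(3 * k).+1]addn1.
by rewrite mulnC modnMl !modnMDl.
Qed.

(* The position of a cell inside a period is the effective resistance from the
   first cell of the period, as a fraction of that of the whole period: consecutive
   cells of sizes [p] and [q] are at resistance [1 / (p * q)]. *)
Definition cell_weight (a b c j : nat) : R :=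
  nth 0 [:: 0; c%:R; (c + a)%:R] (j %% 3) / (a + b + c)%:R.

Definition interp (phi : nat -> R) (a b c j : nat) : R :=
  phi (j %/ 3)%N + cell_weight a b c j * (phi (j %/ 3).+1 - phi (j %/ 3)%N).

Lemma interp_mod3 phi a b c k (D := (a + b + c)%:R) (u := phi k.+1 - phi k) :
  (0 < a + b + c)%N ->
  (interp phi a b c (3 * k) = phi k) *
  (interp phi a b c (3 * k).+1 = phi k + c%:R / D * u) *
  (interp phi a b c (3 * k).+2 = phi k + (c + a)%:R / D * u) *
  (interp phi a b c (3 * k).+3 = phi k.+1).
Proof.
move=> D0; rewrite /interp /cell_weight -[(3 * k).+3]addn3 -[(3 * k).+2]addn2 -[(3 * k).+1]addn1.
rewrite mulnC modnMl !modnMDl mulnK // !divnMDl // /= !addn0 addn1.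
by rewrite !mul0r !addr0.
Qed.

(** With D = a + b + c, conductances ab, bc, ca meet drops in proportion c/D, a/D, b/D, and abc^2 +
    bca^2 + cab^2 = abcD. *)
Lemma interp_energy phi a b c m : (0 < a + b + c)%N ->
  \sum_(j < 3 * m) (cell_size a b c j * cell_size a b c j.+1)%:R *
     (interp phi a b c j - interp phi a b c j.+1) ^+ 2 =
  (a * b * c)%:R / (a + b + c)%:R * \sum_(k < m) (phi k.+1 - phi k) ^+ 2.
Proof.
move=> D0; have Dn0 : a%:R + b%:R + c%:R != 0 :> R by rewrite -!natrD pnatr_eq0 -lt0n.
rewrite (big_ord_mul3 (fun j => (cell_size a b c j * cell_size a b c j.+1)%:R *
     (interp phi a b c j - interp phi a b c j.+1) ^+ 2)) mulr_sumr.
apply: eq_bigr => k _; rewrite !cell_size_mod3 !interp_mod3 //.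
by rewrite !natrM !natrD; field.
Qed.

Lemma sum_cellgraph a b c m (F : nat -> R) :
  \sum_(x : cellgraph a b c m) F (tag x %/ 3)%N = (a + b + c)%:R * \sum_(k < m) F k.
Proof.
rewrite (sum_seqjoin_clique _ (cell_size a b c) (fun j => F (j %/ 3)%N)).
rewrite (big_ord_mul3 (fun j => F (j %/ 3)%N *+ cell_size a b c j)) mulr_sumr.
apply: eq_bigr => k _; rewrite !cell_size_mod3.
rewrite -[(3 * k).+2]addn2 -[(3 * k).+1]addn1 mulnC mulnK // !divnMDl //= !addn0.
by rewrite -!mulrnDr mulr_natl.
Qed.

(** [P] selects at most one cell, and a cell has at most a + b + c vertices. *)
Lemma sum_cell_le a b c m (P : pred nat) (F : cellgraph a b c m -> R) (B : R) :
  0 <= B -> (forall r r', P r -> P r' -> r = r') ->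
  (forall x : cellgraph a b c m, P (tag x) -> F x <= B) ->
  \sum_(x : cellgraph a b c m | P (tag x)) F x <= (a + b + c)%:R * B.
Proof.
move=> B0 uP FB; rewrite big_mkcond sum_tagged /=.
have step (j : 'I_(3 * m)) : \sum_(x : clique (cell_size a b c j))
    (if P j then F (Tag (fun j : 'I_(3 * m) => clique (cell_size a b c j)) x) else 0) <=
    if P j then (a + b + c)%:R * B else 0.
  case: ifP => Pj; last by rewrite big1.
  apply: le_trans (_ : \sum_(x : clique (cell_size a b c j)) B <= _).
    by apply: ler_sum => x _; apply: FB.
  rewrite sumr_const card_ord -[B *+ _]mulr_natl ler_wpM2r // ler_nat /cell_size.
  by case: (_ %% 3)%N => [|[|[|?]]] /=; rewrite ?nth_nil; lia.
apply: le_trans (ler_sum _ (fun j _ => step j)) _; rewrite -big_mkcond /=.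
apply: sum_unique_le => //; first by rewrite mulr_ge0.
by move=> i j Pi Pj; apply: val_inj; apply: uP.
Qed.

Lemma cell_weight_itv a b c j : 0 <= cell_weight a b c j <= 1.
Proof.
rewrite /cell_weight; have [->|D0] := posnP (a + b + c).
  by rewrite invr0 mulr0 lexx ler01.
apply/andP; split.
  by case: (_ %% 3)%N => [|[|[|?]]] /=; rewrite ?nth_nil ?mul0r ?divr_ge0.
rewrite ler_pdivrMr ?mul1r ?ltr0n //.
by case: (_ %% 3)%N => [|[|[|?]]] /=; rewrite ?nth_nil // ler_nat; lia.
Qed.

(** * The test function on the whole chain of blocks *)

Section GammaTest.
Variables (d t : nat) (a b c m : 'I_t -> nat).
Hypothesis abc : forall i, (a i + b i + c i)%N = d.+1.
Variable phi : nat -> R.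

Definition period (u : Gamma a b c m) : nat :=
  (offset m (tag u) + tag (tagged u) %/ 3)%N.

Definition test_fun (u : Gamma a b c m) : R :=
  let i := tag u in
  interp (fun k => phi (offset m i + k)%N) (a i) (b i) (c i) (tag (tagged u)).

Lemma sum_period (F : nat -> R) :
  \sum_u F (period u) = d.+1%:R * \sum_(k < \sum_i m i) F k.
Proof.
rewrite sum_tagged -sum_offset mulr_sumr; apply: eq_bigr => i _.
by rewrite (sum_cellgraph _ _ _ _ (fun k => F (offset m i + k)%N)) abc.
Qed.

Lemma test_fun_near (u : Gamma a b c m) :
  `|test_fun u - phi (period u)| <= `|phi (period u).+1 - phi (period u)|.
Proof.
case: u => i u; rewrite /test_fun /period /interp /= addnS addrAC subrr add0r normrM.
have [w0 w1] := andP (cell_weight_itv (a i) (b i) (c i) (tag u)).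
by rewrite ger0_norm // ler_piMl.
Qed.

Lemma test_fun_near_succ (u : Gamma a b c m) :
  `|test_fun u - phi (period u).+1| <= `|phi (period u).+1 - phi (period u)|.
Proof.
case: u => i u; rewrite /test_fun /period /interp /= addnS.
have [w0 w1] := andP (cell_weight_itv (a i) (b i) (c i) (tag u)).
set w := cell_weight _ _ _ _ in w0 w1 *; set x := phi _; set y := phi _.
have -> : x + w * (y - x) - y = - ((1 - w) * (y - x)) by ring.
rewrite normrN normrM ger0_norm ?subr_ge0 // ler_piMl //.
by rewrite lerBlDr lerDl.
Qed.

(** The first cell of the next block has value [phi (period u).+1], the right end of the interval
    over which [test_fun u] interpolates. *)
Lemma test_fun_bridge_le (delta : R) (u v : Gamma a b c m) :
  (forall k, `|phi k.+1 - phi k| <= delta) ->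
  (tag u).+1 = tag v :> nat -> last_cell (tagged u) -> first_cell (tagged v) ->
  (test_fun u - test_fun v) ^+ 2 <= delta ^+ 2.
Proof.
move=> le_delta uv /eqP lastu /eqP firstv.
have -> : test_fun v = phi (period u).+1.
  rewrite /test_fun /period /interp /cell_weight firstv /= !mul0r addr0 addn0.
  rewrite -uv offsetS; congr (phi _).
  have arith o n x : x.+1 = (3 * n)%N -> (o + n = (o + x %/ 3).+1)%N by lia.
  exact: arith.
have delta0 : 0 <= delta by apply: le_trans (le_delta 0%N).
rewrite -[_ ^+ 2]real_normK ?num_real // lerXn2r ?nnegrE //.
exact: le_trans (test_fun_near_succ u) _.
Qed.

Lemma dirichlet_test_fun_le (L : nat) (delta : R) :
  (forall i, (a i * b i * c i <= L)%N) ->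
  (forall k, `|phi k.+1 - phi k| <= delta) ->
  dirichlet test_fun <=
   (L%:R / d.+1%:R * \sum_(k < \sum_i m i) (phi k.+1 - phi k) ^+ 2 +
    (t * (d.+1 * d.+1))%:R * delta ^+ 2) *+ 2.
Proof.
move=> leL le_delta.
have delta0 : 0 <= delta by apply: le_trans (le_delta 0%N).
have D0 i : (0 < a i + b i + c i)%N by rewrite abc.
apply: le_trans (dirichlet_chain_le _) _; rewrite mulrnDl; apply: lerD.
  rewrite -(sum_offset m (fun k => (phi k.+1 - phi k) ^+ 2)) mulr_sumr -sumrMnl.
  apply: ler_sum => i _.
  apply: le_trans (dirichlet_clique_chain_le _ (cell_size (a i) (b i) (c i))
    (interp (fun k => phi (offset m i + k)%N) (a i) (b i) (c i))) _.
  rewrite lerMn2r interp_energy //= abc; under eq_bigr do rewrite addnS.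
  rewrite ler_wpM2r ?sumr_ge0 // => [k _|]; first exact: sqr_ge0.
  by rewrite ler_wpM2r ?invr_ge0 // ler_nat.
(* Each block has at most one successor, and each junction at most (d + 1)^2 edges. *)
rewrite lerMn2r /= natrM -mulrA -[t in t%:R]card_ord -sum1_card natr_sum mulr_suml.
apply: ler_sum => i _; rewrite mul1r.
apply: sum_unique_le => [|j j' /eqP ij /eqP ij'|j /eqP ij].
- by rewrite mulr_ge0 ?sqr_ge0.
- by apply: val_inj; rewrite -[LHS]ij.
apply: le_trans (_ : d.+1%:R * (d.+1%:R * delta ^+ 2) <= _); last first.
  by rewrite natrM mulrA.
rewrite -[in X in X * _](abc i); apply: (sum_cell_le (P := fun r => r.+1 == (3 * m i)%N)).
- by rewrite mulr_ge0 ?sqr_ge0.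
- by move=> r r' /eqP e /eqP e'; apply: succn_inj; rewrite e.
move=> x lastx; rewrite -(abc j); apply: (sum_cell_le (P := fun r => r == 0%N)) => [||y firsty].
- exact: sqr_ge0.
- by move=> r r' /eqP -> /eqP ->.
by apply: test_fun_bridge_le.
Qed.

End GammaTest.
End Chain.

(** * The slowest mode of a path *)

Section Cosines.
Variable R : realType.
Implicit Types x y : R.

Lemma sin_le_id x : 0 <= x -> sin x <= x.
Proof.
move=> x0; have [|z _] := @MVT_segment R sin cos 0 x x0.
  by apply: continuous_subspaceT; exact: continuous_sin.
rewrite sin0 !subr0 => ->.
by rewrite ler_piMl // cos_le1.
Qed.

(** Telescoping, since 2 sin x cos B = sin (B + x) - sin (B - x). *)
Lemma sum_cos_arith x y M :
  (sin x * \sum_(k < M) cos (x *+ k.*2.+1 + y)) *+ 2 = sin (x *+ M.*2 + y) - sin y.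
Proof.
elim: M => [|M IH]; first by rewrite big_ord0 mulr0 mul0rn mulr0n add0r subrr.
rewrite big_ord_recr /= mulrDr mulrnDl IH.
set B := x *+ M.*2.+1 + y.
have -> : x *+ M.+1.*2 + y = B + x by rewrite /B doubleS mulrSr; ring.
have -> : x *+ M.*2 + y = B - x by rewrite /B mulrSr; ring.
by rewrite (sinB B) (sinD B); ring.
Qed.

Section PathMode.
Variable M : nat.
Let theta : R := pi / (M.*2)%:R.

(* Its values at [M.-1] and [M] agree (reflection at the end of the path), so the
   last difference vanishes and sums over [k < M] may include it. *)
Definition path_mode (k : nat) : R := cos (theta *+ k.*2.+1).

Hypothesis M2 : (2 <= M)%N.

Let M0 : 0 < (M.*2)%:R :> R. Proof. by rewrite ltr0n; lia. Qed.

Let theta_gt0 : 0 < theta. Proof. by rewrite divr_gt0 ?pi_gt0. Qed.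

Let theta_M : theta *+ M.*2 = pi.
Proof. by rewrite -mulr_natr divfK // gt_eqF. Qed.

Let piM : pi / M%:R = theta *+ 2.
Proof.
rewrite /theta -muln2 natrM -mulr_natr; field.
by rewrite pnatr_eq0; lia.
Qed.

Let sin_theta : 0 < sin theta.
Proof.
apply: sin_gt0_pi; rewrite theta_gt0 ltr_pdivrMr //= ltr_pMr ?pi_gt0 // ltr1n; lia.
Qed.

Let sin_2theta : 0 < sin (theta *+ 2).
Proof.
apply: sin_gt0_pi; rewrite pmulrn_lgt0 // theta_gt0 /= -[X in _ < X]theta_M ltr_pMn2l //; lia.
Qed.

Lemma sum_path_mode : \sum_(k < M) path_mode k = 0.
Proof.
have := sum_cos_arith theta 0 M; under eq_bigr do rewrite addr0.
rewrite addr0 theta_M sinpi sin0 subr0 => /eqP.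
by rewrite mulrn_eq0 /= mulf_eq0 (gt_eqF sin_theta) => /eqP.
Qed.

(** At the doubled angle the telescoped sum spans a full period 2 pi; the factor sin (2 theta) can
    be cancelled because [M] is at least 2. *)
Let sum_cos2 y : \sum_(k < M) cos (theta *+ 2 *+ k.*2.+1 + y) = 0.
Proof.
have := sum_cos_arith (theta *+ 2) y M.
rewrite mulrnAC theta_M [pi *+ 2 + y]addrC sinD2pi subrr => /eqP.
by rewrite mulrn_eq0 /= mulf_eq0 (gt_eqF sin_2theta) => /eqP.
Qed.

Lemma sum_path_mode_sqr : \sum_(k < M) path_mode k ^+ 2 = M%:R / 2.
Proof.
transitivity (\sum_(k < M) (2^-1 + cos (theta *+ 2 *+ k.*2.+1 + 0) / 2)).
  by apply: eq_bigr => k _; rewrite addr0 mulrnAC cos_mulr2n /path_mode; field.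
by rewrite big_split /= -mulr_suml sum_cos2 mul0r addr0 sumr_const card_ord mulr_natl.
Qed.

Lemma path_modeS k :
  path_mode k.+1 - path_mode k = - (sin theta * sin (theta *+ k.+1.*2)) *+ 2.
Proof.
rewrite /path_mode; set B := theta *+ k.+1.*2.
have -> : theta *+ k.+1.*2.+1 = B + theta by rewrite /B mulrSr.
have -> : theta *+ k.*2.+1 = B - theta by rewrite /B doubleS [theta *+ k.*2.+2]mulrSr addrK.
by rewrite (cosB B) (cosD B); ring.
Qed.

Lemma path_mode_diff k : `|path_mode k.+1 - path_mode k| <= pi / M%:R.
Proof.
rewrite path_modeS mulNrn normrN normrMn normrM (gtr0_norm sin_theta) piM.
rewrite lerMn2r /= -[leRHS]mulr1 ler_pM ?sin_max //.
  exact: ltW.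
by rewrite sin_le_id // ltW.
Qed.

(** Each difference is, up to sign, 2 sin theta times a sine whose squares average 1/2, and 2 sin
    theta <= 2 theta = pi / M. *)
Lemma sum_path_mode_diff_sqr :
  \sum_(k < M) (path_mode k.+1 - path_mode k) ^+ 2 <= (pi / M%:R) ^+ 2 * (M%:R / 2).
Proof.
rewrite piM.
have -> : \sum_(k < M) (path_mode k.+1 - path_mode k) ^+ 2 =
    (sin theta *+ 2) ^+ 2 * (M%:R / 2).
  transitivity (\sum_(k < M) (sin theta *+ 2) ^+ 2 *
      (2^-1 - cos (theta *+ 2 *+ k.*2.+1 + theta *+ 2) / 2)).
    apply: eq_bigr => k _; rewrite path_modeS -mulrSr.
    have -> : theta *+ 2 *+ k.*2.+2 = theta *+ k.+1.*2 *+ 2 by rewrite mulrnAC.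
    by rewrite cos_mulr2n cos2sin2; field.
  rewrite -mulr_sumr big_split /= sumrN -mulr_suml sum_cos2 mul0r subr0.
  by rewrite sumr_const card_ord mulr_natl.
rewrite ler_wpM2r ?divr_ge0 // lerXn2r ?nnegrE ?mulrn_wge0 ?(ltW theta_gt0) //.
  exact: ltW.
by rewrite lerMn2r /= sin_le_id // ltW.
Qed.

End PathMode.
End Cosines.

(** * The eigenvalue bound *)

Section LargeOrder.
Variable R : realType.

Lemma sqr_ge_perturb (x e delta : R) :
  `|x| <= 1 -> `|e| <= delta -> x ^+ 2 - delta *+ 2 <= (x + e) ^+ 2.
Proof.
move=> x1 ed; have : `|x * e| <= delta.
  by rewrite normrM -[leRHS]mul1r ler_pM.
by rewrite ler_norml => /andP[xe _]; have := sqr_ge0 e; rewrite sqrrD; lra.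
Qed.

(** Per factor d + 1, [C0] bounds the loss of variance: 2 pi from replacing [phi] by the test
    function, pi^2 from the nonzero mean. [C1] absorbs the energy of the junctions. *)
Lemma mu_Gamma_le d t (a b c m : 'I_t -> nat) (L : nat)
    (M := (\sum_i m i)%N) (C0 : R := pi *+ 2 + pi ^+ 2)
    (C1 : R := (t * d.+1 ^ 3)%:R) :
  (forall i, a i + b i + c i = d.+1)%N ->
  (forall i, a i * b i * c i <= L)%N -> (0 < L)%N -> (2 <= M)%N ->
  C0 < M%:R / 2 ->
  mu R (Gamma a b c m) <=
    L%:R * pi ^+ 2 / (d.+1 * M)%:R ^+ 2 * ((M%:R / 2 + C1) / (M%:R / 2 - C0)).
Proof.
move=> abc leL L0 M2 ltC0.
pose phi := path_mode R M; pose delta : R := pi / M%:R.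
have Mgt0 : 0 < M%:R :> R by rewrite ltr0n ltnW.
have piD : delta * M%:R = pi by rewrite divfK // gt_eqF.
have pi0 : 0 <= pi :> R := pi_ge0 R.
have delta0 : 0 <= delta by rewrite divr_ge0 // ltW.
pose f := @test_fun R t a b c m phi.
have near_phi u : `|f u - phi (period u)| <= delta.
  exact: le_trans (test_fun_near phi u) (path_mode_diff R M2 _).
have sum_const (x : R) : \sum_(u : Gamma a b c m) x = d.+1%:R * (M%:R * x).
  have := sum_period m abc (fun _ => x).
  by rewrite [in RHS]sumr_const card_ord -[x *+ _]mulr_natl.
have S1 : `|\sum_u f u| <= d.+1%:R * pi.
  have -> : \sum_u f u = \sum_u (f u - phi (period u)).
    by rewrite sumrB (sum_period m abc phi) sum_path_mode // mulr0 subr0.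
  apply: le_trans (ler_norm_sum _ _ _) _.
  apply: le_trans (ler_sum _ (fun u _ => near_phi u)) _.
  by rewrite sum_const [M%:R * _]mulrC piD.
have S2 : d.+1%:R * (M%:R / 2 - pi *+ 2) <= \sum_u f u ^+ 2.
  have -> : d.+1%:R * (M%:R / 2 - pi *+ 2) =
      \sum_(u : Gamma a b c m) (phi (period u) ^+ 2 - delta *+ 2).
    rewrite sumrB (sum_period m abc (fun k => phi k ^+ 2)) sum_path_mode_sqr //.
    by rewrite sum_const -mulrBr -piD; congr (_ * (_ - _)); ring.
  apply: ler_sum => u _; rewrite -[f u](subrKC (phi (period u))).
  by apply: sqr_ge_perturb; rewrite ?cos_max ?near_phi.
have Dgt0 : 0 < d.+1%:R :> R by rewrite ltr0n.
have cardG : #|Gamma a b c m|%:R = d.+1%:R * M%:R :> R by rewrite (card_Gamma m abc) natrM.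
have V : d.+1%:R * (M%:R / 2 - C0) <=
    \sum_u f u ^+ 2 - (\sum_u f u) ^+ 2 / #|Gamma a b c m|%:R.
  have : (\sum_u f u) ^+ 2 / #|Gamma a b c m|%:R <= d.+1%:R * pi ^+ 2.
    rewrite cardG ler_pdivrMr ?mulr_gt0 //.
    apply: le_trans (_ : (d.+1%:R * pi) ^+ 2 <= _).
      by rewrite -[_ ^+ 2]real_normK ?num_real // lerXn2r ?nnegrE ?mulr_ge0.
    rewrite [leRHS](_ : _ = (d.+1%:R * pi) ^+ 2 * M%:R); last by ring.
    by rewrite ler_peMr ?sqr_ge0 // ler1n ltnW.
  rewrite /C0; lra.
have E := le_trans (mu_rayleigh f)
  (dirichlet_test_fun_le m abc leL (path_mode_diff R M2)).
rewrite lerMn2r /= -/M -/delta in E.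
have X0 : 0 < M%:R / 2 - C0 by rewrite subr_gt0.
have C1_ge0 : 0 <= C1 by [].
rewrite mulrA ler_pdivlMr //.
(* The lower bound [V] on the variance may be multiplied by [mu] only when [mu] is nonnegative. *)
have [mu_le0|mu_gt0] := lerP (mu R (Gamma a b c m)) 0.
  apply: le_trans (_ : 0 <= _); first by rewrite mulr_le0_ge0 // ltW.
  by rewrite mulr_ge0 ?divr_ge0 ?addr_ge0 ?mulr_ge0 ?sqr_ge0 ?divr_ge0 // ltW.
have {}E : mu R (Gamma a b c m) * (d.+1%:R * (M%:R / 2 - C0)) <=
    L%:R / d.+1%:R * (delta ^+ 2 * (M%:R / 2)) + (t * (d.+1 * d.+1))%:R * delta ^+ 2.
  apply: le_trans (ler_wpM2l (ltW mu_gt0) V) _; apply: le_trans E _.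
  rewrite lerD2r ler_wpM2l ?divr_ge0 ?ler0n //.
  exact: sum_path_mode_diff_sqr.
rewrite -(ler_pM2l Dgt0) [leLHS]mulrCA; apply: le_trans E _.
(* The target carries an extra factor [L] on the junction term, harmless as [L] is at least 1. *)
have -> : d.+1%:R * (L%:R * pi ^+ 2 / (d.+1 * M)%:R ^+ 2 * (M%:R / 2 + C1)) =
    L%:R / d.+1%:R * (delta ^+ 2 * (M%:R / 2)) + L%:R * ((t * (d.+1 * d.+1))%:R * delta ^+ 2).
  rewrite /delta /C1 !natrM; field.
  by rewrite !gt_eqF.
rewrite lerD2l ler_peMl ?mulr_ge0 ?sqr_ge0 //.
by rewrite ler1n.
Qed.

End LargeOrder.

(** * From the explicit bound to an error term depending on the order alone *)

Unset Implicit Arguments.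

Theorem theorem5 (R : realType) (d t : nat) (a b c : 'I_t -> nat)
  (hd : (2 <= d)%N) (ht : (1 <= t)%N)
  (ha : forall i, (0 < a i)%N) (hb : forall i, (0 < b i)%N)
  (hc : forall i, (0 < c i)%N)
  (habc : forall i, (a i + b i + c i)%N = d.+1) :
  let L := (\max_(j < t) (a j * b j * c j))%N in
  exists o : nat -> R,
    (o n @[n --> \oo] --> (0 : R)) /\
    forall m : 'I_t -> nat, (forall i, (0 < m i)%N) ->
      let n := #|Gamma a b c m| in
      mu R (Gamma a b c m) <= (1 + o n) * (L%:R * pi ^+ 2 / n%:R ^+ 2).
Proof.
move=> L.
have leL i : (a i * b i * c i <= L)%N by exact: (@leq_bigmax _ (fun j => (a j * b j * c j)%N)).
have L0 : (0 < L)%N by apply: leq_trans (leL (Ordinal ht)); rewrite !muln_gt0 ha hb hc.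
pose C0 : R := pi *+ 2 + pi ^+ 2; pose C1 : R := (t * d.+1 ^ 3)%:R.
pose D : R := d.+1%:R; pose K := D * (C1 + C0).
(* Block lengths of a graph of order [n] are at most [n], so this finite sum dominates [mu] of every
   such graph. *)
pose S n : R := \sum_(g : {ffun 'I_t -> 'I_n.+1}) `|mu R (Gamma a b c (fun i => g i : nat))|.
(* For large [n] this is (M/2 + C1) / (M/2 - C0) - 1 written with n = D M. For small [n] the claimed
   bound becomes the main term plus [S n]. *)
pose o n : R := if D * C0 < n%:R / 2 then K / (n%:R / 2 - D * C0)
  else S n / (L%:R * pi ^+ 2 / n%:R ^+ 2).
have pi0 : 0 < pi :> R := pi_gt0 R.
have C0_ge4 : 4 <= C0 by have := pi_ge2 R; rewrite /C0; nra.
have D0 : 0 < D by rewrite ltr0n.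
have K0 : 0 < K by rewrite mulr_gt0 // ltr_wpDl //; lra.
exists o; split.
  apply/cvgrPdist_lt => e e0; near=> n.
  (* Exactly the threshold beyond which [o n] falls below [e]. *)
  have big : D * C0 + K / e < n%:R / 2.
    rewrite ltr_pdivlMr //; near: n; exact: nbhs_infty_gtr.
  have Ke : 0 < K / e by rewrite divr_gt0.
  have lt : D * C0 < n%:R / 2 by lra.
  have Y0 : 0 < n%:R / 2 - D * C0 by rewrite subr_gt0.
  rewrite /o lt sub0r normrN ger0_norm ?divr_ge0 ?(ltW Y0) ?(ltW K0) //.
  by rewrite ltr_pdivrMr // [e * _]mulrC -ltr_pdivrMr // ltrBrDl.
move=> m m0; cbv zeta; set n := #|_|; pose M := (\sum_i m i)%N.
have nE : n = (d.+1 * M)%N := card_Gamma m habc.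
have M0 : (0 < M)%N by rewrite /M (bigD1 (Ordinal ht)) //= ltn_addr.
have n0 : (0 < n)%N by rewrite nE muln_gt0.
have X0 : 0 < L%:R * pi ^+ 2 / n%:R ^+ 2 :> R.
  by rewrite !(divr_gt0, mulr_gt0, exprn_gt0) ?ltr0n.
rewrite /o; case: ifP => [lt|_].
  have nR : n%:R = D * M%:R by rewrite nE natrM.
  have ltM : C0 < M%:R / 2 by rewrite -(ltr_pM2l D0) mulrA -nR.
  (* Here M/2 > [C0] >= 4. *)
  have M2 : (2 <= M)%N by rewrite -(ler_nat R); lra.
  apply: le_trans (mu_Gamma_le habc leL L0 M2 ltM) _.
  rewrite -nE mulrC le_eqVlt; apply/orP; left; apply/eqP; congr (_ * _).
  have Y0 : M%:R / 2 - C0 != 0 by rewrite subr_eq0 gt_eqF.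
  rewrite nR /K -/M -/C0 -/C1 -[D * _ / 2]mulrA -mulrBr -mulf_div divff ?gt_eqF // mul1r.
  have -> : M%:R / 2 + C1 = (M%:R / 2 - C0) + (C1 + C0) by ring.
  by rewrite mulrDl divff.
rewrite mulrDl mul1r divfK ?gt_eqF //.
apply: le_trans (ler_norm _) _; apply: ler_wpDl; first exact: ltW.
have mn i : (m i < n.+1)%N.
  by rewrite ltnS nE /M (bigD1 i) //= mulnDr -addnA; lia.
pose g := [ffun i => Ordinal (mn i)] : {ffun 'I_t -> 'I_n.+1}.
have -> : Gamma a b c m = Gamma a b c (fun i => g i : nat).
  by congr Gamma; apply/funext => i; rewrite ffunE.
rewrite /S (bigD1 g) //= lerDl sumr_ge0 //.
Unshelve. all: by end_near.
Qed.
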